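(* Let $G$ be a bridgeless graph with diameter $2$. Then $rc(G)\leq 5$.
   Context: All graphs are finite, simple and undirected; a graph is bridgeless if no edge's removal disconnects it. In an edge-colored graph (adjacent edges may receive the same color), a path is a rainbow path if no two of its edges have the same color. The rainbow connection number $rc(G)$ of a connected graph $G$ is the minimum integer $i$ such that there is an edge-coloring of $G$ with $i$ colors in which every two distinct vertices of $G$ are connected by a rainbow path. *)

(* Defs.v *)
From mathcomp Require Import all_boot.

Set Implicit Arguments.
Unset Strict Implicit.
Unset Printing Implicit Defensive.

Record sgraph := SGraph {
  vertex :> finType;
  adj : rel vertex;
  adj_sym : symmetric adj;
  adj_irrefl : irreflexive adj }.

Arguments adj {G} : rename.

Definition edges (G : sgraph) : {set {set G}} :=
  [set [set xy.1; xy.2] | xy : G * G & adj xy.1 xy.2].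

Definition edge (G : sgraph) := {E : {set G} | E \in edges G}.

Definition connected (G : sgraph) : bool :=
  [forall x : G, forall y : G, connect adj x y].

Section DeleteEdge.
Variables (G : sgraph) (E : {set G}).

Definition del_edge_adj : rel G :=
  [rel x y | adj x y && ([set x; y] != E)].

Lemma del_edge_sym : symmetric del_edge_adj.
Proof. by move=> x y; rewrite /del_edge_adj /= adj_sym setUC. Qed.

Lemma del_edge_irrefl : irreflexive del_edge_adj.
Proof. by move=> x; rewrite /del_edge_adj /= adj_irrefl. Qed.

Definition del_edge : sgraph := SGraph del_edge_sym del_edge_irrefl.

End DeleteEdge.

(* The notion is meant for connected graphs. *)
Definition bridgeless (G : sgraph) : Prop :=
  forall E : {set G}, E \in edges G -> connected (del_edge E).

(* The path x :: p, of length [size p], leads from x to y without repeating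
   a vertex. *)
Definition is_path (G : sgraph) (x y : G) (p : seq G) : bool :=
  [&& path adj x p, last x p == y & uniq (x :: p)].

(* Bounded sequences make the set of candidate paths finite: a path has at
   most #|G| vertices.  The value #|G| is returned when there is no path. *)
Definition dist (G : sgraph) (x y : G) : nat :=
  \big[minn/#|G|]_(p : #|G|.-bseq G | is_path x y p) size p.

(* [None] stands for the infinite diameter of a disconnected graph. *)
Definition diameter (G : sgraph) : option nat :=
  if connected G then Some (\max_(x : G) \max_(y : G) dist x y) else None.

(* Along a path every consecutive pair is an edge, so [insub] drops nothing
   (see [size_path_edges]). *)
Definition path_edges (G : sgraph) (x : G) (p : seq G) : seq (edge G) :=
  pmap insub (pairmap (fun u v => [set u; v]) x p).

Definition rainbow (G : sgraph) (k : nat) (c : {ffun edge G -> 'I_k})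
    (x : G) (p : seq G) : bool :=
  uniq [seq c E | E <- path_edges x p].

Definition rainbow_coloring (G : sgraph) (k : nat)
    (c : {ffun edge G -> 'I_k}) : bool :=
  [forall x : G, forall y : G, (x != y) ==>
     [exists p : #|G|.-bseq G, is_path x y p && rainbow c x p]].

Definition rainbow_colorable (G : sgraph) (k : nat) : bool :=
  [exists c : {ffun edge G -> 'I_k}, rainbow_coloring c].

(* In a connected graph #|edge G| colors suffice (see [rcP]); the value on a
   disconnected graph is meaningless. *)
Definition rc (G : sgraph) : nat :=
  \big[minn/#|{: edge G}|]_(k < #|{: edge G}| | rainbow_colorable G k) k.

Lemma size_path_edges (G : sgraph) (x : G) (p : seq G) :
  path adj x p -> size (path_edges x p) = size p.
Proof.
rewrite /path_edges; elim: p x => //= y p IHp x /andP[xy yp].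
by rewrite insubT /= ?IHp //; apply/imsetP; exists (x, y); rewrite ?inE.
Qed.

Lemma is_path_size (G : sgraph) (x y : G) (p : seq G) :
  is_path x y p -> size p <= #|G|.
Proof.
case/and3P=> _ _ /card_uniqP /= szp; apply: ltnW.
by rewrite -szp max_card.
Qed.

Lemma connected_path (G : sgraph) (x y : G) :
  connected G -> exists p, is_path x y p.
Proof.
move=> /forallP/(_ x)/forallP/(_ y)/connectP[p xp ->].
by case/shortenP: xp => q xq uq _; exists q; rewrite /is_path xq eqxx.
Qed.

Lemma bigminn_le (I : finType) (P : pred I) (F : I -> nat) (m : nat) :
  \big[minn/m]_(i | P i) F i <= m /\
  (forall i, P i -> \big[minn/m]_(i | P i) F i <= F i).
Proof.
split=> [|i Pi].
  by elim/big_rec: _ => // i n _; rewrite geq_min => ->; rewrite orbT.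
rewrite -big_filter; have: i \in [seq j <- index_enum I | P j].
  by rewrite mem_filter Pi mem_index_enum.
elim: filter => // j s IHs; rewrite inE big_cons geq_min => /predU1P[<-|/IHs->].
  by rewrite leqnn.
by rewrite orbT.
Qed.

Lemma bigminn_attained (I : finType) (P : pred I) (F : I -> nat) (m : nat) :
  \big[minn/m]_(i | P i) F i = m \/
  (exists2 i, P i & \big[minn/m]_(i | P i) F i = F i).
Proof.
elim/big_rec: _ => [|i n Pi IHn]; first by left.
rewrite /minn; case: ifP => _ //; by right; exists i.
Qed.

Lemma distP (G : sgraph) (x y : G) : connected G ->
  (exists2 p, is_path x y p & size p = dist x y) /\
  (forall p, is_path x y p -> dist x y <= size p).
Proof.
move=> cG; have min_dist p : is_path x y p -> dist x y <= size p.
  move=> xp; have sp := is_path_size xp.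
  by have [_ /(_ (Bseq sp) xp)] := bigminn_le
    (fun p : #|G|.-bseq G => is_path x y p) (fun p => size p) #|G|.
split=> //; have [dE|[p xp dE]] := bigminn_attained
    (fun p : #|G|.-bseq G => is_path x y p) (fun p => size p) #|G|.
  have [p xp] := connected_path x y cG; exists p => //.
  by apply/eqP; rewrite eqn_leq min_dist // /dist dE (is_path_size xp).
by exists p.
Qed.

Lemma rainbow_coloringP (G : sgraph) (k : nat) (c : {ffun edge G -> 'I_k}) :
  reflect (forall x y : G, x != y ->
             exists2 p : seq G, is_path x y p & rainbow c x p)
          (rainbow_coloring c).
Proof.
apply: (iffP forallP) => [H x y xy | H x].
  have /forallP/(_ y)/implyP/(_ xy)/existsP[p /andP[xp rp]] := H x.
  by exists p.
apply/forallP=> y; apply/implyP=> /H[p xp rp].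
by apply/existsP; exists (Bseq (is_path_size xp)); rewrite /= xp.
Qed.

Lemma uniq_path_edges (G : sgraph) (x : G) (p : seq G) :
  uniq (x :: p) -> uniq (path_edges x p).
Proof.
move=> up; rewrite /path_edges; apply: (pmap_uniq (g := val)).
  exact: insubK.
elim: p x up => //= y p IHp x /and3P[xNyp yNp up].
rewrite IHp /= ?yNp // andbT; apply/negP => H.
have: all (fun E : {set G} => E \subset [set z in y :: p])
          (pairmap (fun u v => [set u; v]) y p).
  elim: p y {IHp xNyp yNp up H} => //= z p IHp y; apply/andP; split.
    by apply/subsetP=> w; rewrite !inE => /orP[]->; rewrite ?orbT.
  apply: sub_all (IHp z) => E /subset_trans; apply.
  by apply/subsetP=> w; rewrite !inE => ->; rewrite orbT.
move=> /allP/(_ _ H)/subsetP/(_ x).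
by rewrite !inE eqxx => /(_ isT); rewrite -in_cons (negPf xNyp).
Qed.

Lemma rcP (G : sgraph) : connected G ->
  rainbow_colorable G (rc G) /\
  (forall k, rainbow_colorable G k -> rc G <= k).
Proof.
move=> cG; split; last first.
  have [rc_m rc_min] := bigminn_le
    (fun k : 'I_#|{: edge G}| => rainbow_colorable G k) (fun k => k) #|{: edge G}|.
  move=> k ck; have [km|mk] := ltnP k #|{: edge G}|.
    exact: rc_min (Ordinal km) ck.
  exact: leq_trans rc_m mk.
rewrite /rc; have [->|[k ck ->] //] := bigminn_attained
  (fun k : 'I_#|{: edge G}| => rainbow_colorable G k) (fun k => k) #|{: edge G}|.
apply/existsP; exists [ffun E => enum_rank E].
apply/rainbow_coloringP=> x y _; have [p xp] := connected_path x y cG.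
exists p => //; rewrite /rainbow map_inj_uniq.
  by apply: uniq_path_edges; case/and3P: xp.
by move=> E F; rewrite !ffunE; apply: enum_rank_inj.
Qed.

(* Main.v *)
(* Let v be a vertex of maximum degree, N its neighbors and F the remaining
   vertices.  Two-color N by f and give an edge from v to u in N the color f u,
   an edge from F to u in N one of two further colors according to f u, and every
   other edge a fifth color.  If each vertex t other than v reaches both classes
   of N by short rainbow paths avoiding v ("arms"), then any two vertices are
   joined by an arm into one class, the passage through v, and an arm out of
   the other class.
   The arms exist if every u in N adjacent to F has a non-neighbor in the other
   class of N: when w in F has no arm to the other class directly or through F,
   then w has a second neighbor in N and a neighbor u in N adjacent to the
   other class, and it is enough to swap the color of the single edge wu.
   Maximality of the degree of v says that u, which has a neighbor outside
   v and N, misses some vertex of N, so f can be read off a maximal independent set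
   of the complement of N.  Bridgelessness matters only when F is empty; there f
   comes from a maximal independent set of the graph induced by N. *)
Require Import Defs.
From mathcomp Require Import all_boot.

Set Implicit Arguments.
Unset Strict Implicit.
Unset Printing Implicit Defensive.

(** * Color words of walks and the rainbow paths inside them *)

Section Walks.
Variables (G : sgraph) (T : finType) (col : G -> G -> T).
Hypothesis colC : forall x y, col x y = col y x.

(** Only the colors are recorded and vertices may repeat, so walks concatenate without any
    disjointness check. *)
Inductive walk : G -> seq T -> G -> Prop :=
| walk0 x : walk x [::] x
| walkS x y z s : adj x y -> walk y s z -> walk x (col x y :: s) z.

Lemma walk1 x y : adj x y -> walk x [:: col x y] y.
Proof. by move=> xy; apply: walkS xy (walk0 y). Qed.

Lemma walk_cat x y z s t : walk x s y -> walk y t z -> walk x (s ++ t) z.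
Proof. by move=> w1 w2; elim: w1 w2 => //= a b e r ab _ IH /IH; apply: walkS. Qed.

Lemma walk_rev x y s : walk x s y -> walk y (rev s) x.
Proof.
elim=> [z|a b e r ab _ IH]; first exact: walk0.
rewrite rev_cons -cats1 colC; apply: walk_cat IH (walk1 _).
by rewrite adj_sym.
Qed.

(** Cutting out closed detours only deletes colors, so a walk with distinct colors contains a
    rainbow path. *)
Lemma walk_path x y s : walk x s y ->
  exists2 p, is_path x y p & subseq (pairmap col x p) s.
Proof.
elim=> [z|a b e r ab _ [p /and3P[bp /eqP lp up] sp]].
  by exists [::]; rewrite // /is_path /= eqxx.
have [ap|aNp] := boolP (a \in b :: p); last first.
  by exists (b :: p); rewrite /is_path /= ?ab ?bp ?lp ?eqxx ?aNp // eqxx.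
case/splitPl: ap bp lp up sp => p1 p2 lp1.
rewrite cat_path last_cat pairmap_cat lp1 => /andP[_ ap2] lp2 up sp.
exists p2; last first.
  apply: subseq_trans (subseq_cons r _).
  exact: subseq_trans (suffix_subseq _ _) sp.
rewrite /is_path ap2 lp2 eqxx /=.
move: up; rewrite -cat_cons cat_uniq => /and3P[_ /hasPn ap1 ->].
by rewrite andbT; apply/negP => /ap1; rewrite -lp1 mem_last.
Qed.

Lemma edge_ends (E : edge G) :
  exists xy : G * G, adj xy.1 xy.2 && (val E == [set xy.1; xy.2]).
Proof.
case: E => E /= /imsetP[xy]; rewrite inE => xyG ->.
by exists xy; rewrite xyG eqxx.
Qed.

(** An edge is an unordered pair, so some orientation is chosen; symmetry of [col] makes the choice
    harmless. *)
Definition edge_col (E : edge G) : T :=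
  let xy := xchoose (edge_ends E) in col xy.1 xy.2.

Lemma edge_colE (E : edge G) x y : val E = [set x; y] -> edge_col E = col x y.
Proof.
move=> Exy; rewrite /edge_col; move: (xchooseP (edge_ends E)).
move: (xchoose _) => [a b] /= /andP[ab]; rewrite Exy => /eqP /setP xyab.
have aNb : a != b by apply: contraTneq ab => ->; rewrite adj_irrefl.
have := xyab a; have := xyab b; rewrite !inE !eqxx orbT /=.
by move=> /orP[] /eqP bE /orP[] /eqP aE; subst a b; rewrite ?eqxx // in aNb *.
Qed.

Lemma map_edge_col x p :
  path adj x p -> [seq edge_col E | E <- path_edges x p] = pairmap col x p.
Proof.
rewrite /path_edges; elim: p x => //= y p IHp x /andP[xy yp].
have xyE : [set x; y] \in edges G by apply/imsetP; exists (x, y); rewrite ?inE.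
by rewrite (insubT (fun E => E \in edges G) xyE) /= IHp // (@edge_colE _ x y).
Qed.

Lemma walk_rainbow_colorable :
    (forall x y, x != y -> exists2 s, walk x s y & uniq s) ->
  rainbow_colorable G #|T|.
Proof.
move=> rainbow_walk; apply/existsP; exists [ffun E => enum_rank (edge_col E)].
apply/rainbow_coloringP => x y /rainbow_walk[s /walk_path[p xyp sp] us].
exists p => //; rewrite /rainbow.
rewrite (eq_map (g := enum_rank \o edge_col)); last by move=> E; rewrite ffunE.
rewrite map_comp (map_inj_uniq enum_rank_inj) map_edge_col ?(subseq_uniq sp) //.
by case/and3P: xyp.
Qed.

End Walks.

(* Membership in a maximal independent set is such an f. *)
Lemma opposite_neighbor (V : finType) (r : rel V) :
    symmetric r -> irreflexive r ->
  exists f : V -> bool, forall x, (exists y, r x y) ->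
    exists2 y, r x y & f y = ~~ f x.
Proof.
move=> rC rI; pose stable (I : {set V}) := [forall x in I, forall y in I, ~~ r x y].
have /maxset_exists[I /maxsetP[stI maxI] _] : stable set0.
  by apply/forall_inP => x; rewrite inE.
exists (mem I) => x [y xy] /=; have [xI|xNI] := boolP (x \in I).
  exists y => //; apply/negP => yI.
  by move/forall_inP/(_ x xI)/forall_inP/(_ y yI): stI; rewrite xy.
have [z /andP[xz zI]|noz] := pickP [pred z | r x z && (z \in I)].
  by exists z.
case/negP: xNI; rewrite -(maxI (x |: I)) ?setU11 ?subsetUr //.
apply/forall_inP => a /setU1P[->|aI]; apply/forall_inP => b /setU1P[->|bI].
- by rewrite rI.
- by have /= := noz b; rewrite bI andbT => ->.
- by have /= := noz a; rewrite aI andbT rC => ->.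
- by move/forall_inP/(_ a aI)/forall_inP/(_ b bI): stI.
Qed.

(** * The coloring around [v] and its rainbow walks *)

Section Coloring.
Variables (G : sgraph) (v : G) (f : G -> bool).

Definition far (w : G) := (w != v) && ~~ adj v w.

Hypothesis diam2 : forall x y : G, x != y -> ~~ adj x y ->
  exists2 t, adj x t & adj t y.
Hypothesis opp_nonadj : forall u w, adj v u -> far w -> adj u w ->
  exists y, [/\ adj v y, ~~ adj u y & f y = ~~ f u].
Hypothesis opp_adj : forall u, adj v u -> (forall w, far w -> ~~ adj u w) ->
  (exists y, [/\ adj v y, adj u y & f y = ~~ f u]) \/
  (exists w y z, [/\ far w, adj w y, adj w z, adj v y & adj v z /\ f y = ~~ f z]).

(* u is a candidate for the end of the edge wu whose color is swapped. *)
Definition is_star (w u : G) :=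
  [&& adj w u, adj v u,
      [exists y, [&& adj v y, adj u y & f y == ~~ f u]],
      [forall y, adj w y && adj v y ==> (f y == f u)] &
      [forall t, forall y, [&& far t, adj w t, adj t y & adj v y] ==> (f y == f u)]].

Definition star (w : G) : option G := [pick u | is_star w u].

(** Colors [inl b] are for edges at [v], [inr (Some b)] for edges between F and N, [inr None] for
    all others. The addition swaps the color of the selected edge. *)
Definition cross (w u : G) : bool + option bool :=
  inr (Some (f u (+) (star w == Some u))).

Definition col (x y : G) : bool + option bool :=
  if x == v then inl (f y) else if y == v then inl (f x) else
  if adj v x then (if adj v y then inr None else cross y x)
  else if adj v y then cross x y else inr None.

Lemma colC x y : col x y = col y x.
Proof.
rewrite /col; case: (eqVneq x v) => [->|_]; case: (eqVneq y v) => [yv|_]; rewrite ?yv //.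
by case: (adj v x); case: (adj v y).
Qed.

Lemma adj_neq (x y : G) : adj x y -> x != y.
Proof. by apply: contraTneq => ->; rewrite adj_irrefl. Qed.

Lemma col_center u : adj v u -> col u v = inl (f u).
Proof. by move=> vu; rewrite colC /col eqxx. Qed.

Lemma col_near u y : adj v u -> adj v y -> col u y = inr None.
Proof.
by move=> vu vy; rewrite /col vu vy eq_sym (negPf (adj_neq vu)) eq_sym (negPf (adj_neq vy)).
Qed.

Lemma col_far w t : far w -> far t -> col w t = inr None.
Proof.
by case/andP=> wv vw /andP[tv vt]; rewrite /col (negPf wv) (negPf vw) (negPf tv) (negPf vt).
Qed.

Lemma col_cross w u : far w -> adj v u -> col w u = cross w u.
Proof.
case/andP=> wv vw vu; rewrite /col (negPf wv) (negPf vw) vu.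
by rewrite eq_sym (negPf (adj_neq vu)).
Qed.

Lemma nbr_far w t : far w -> adj w t -> adj v t \/ far t.
Proof.
move=> /andP[_ vw] wt; have [|vt] := boolP (adj v t); [by left | right].
by rewrite /far vt andbT; apply: contraNneq vw => <-; rewrite adj_sym.
Qed.

Lemma starP w u : star w = Some u -> is_star w u.
Proof. by rewrite /star; case: pickP => // x xstar [<-]. Qed.

Lemma star_mono w u y : star w = Some u -> adj w y -> adj v y -> f y = f u.
Proof.
case/starP/and5P=> _ _ _ /forallP/(_ y) mono _ wy vy.
by apply/eqP; apply: (implyP mono); rewrite wy.
Qed.

Lemma star_far_mono w t u y : star w = Some u ->
  far t -> adj w t -> adj t y -> adj v y -> f y = f u.
Proof.
case/starP/and5P=> _ _ _ _ /forallP/(_ t)/forallP/(_ y) mono Ft wt ty vy.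
by apply/eqP; apply: (implyP mono); rewrite Ft wt ty.
Qed.

Lemma star_mixed w y z : adj w y -> adj w z -> adj v y -> adj v z ->
  f y = ~~ f z -> star w = None.
Proof.
move=> wy wz vy vz yz; case wE: (star w) => [u|//].
by have := star_mono wE wy vy; rewrite yz -(star_mono wE wz vz); case: (f z).
Qed.

Lemma star_None w u : star w = None -> ~~ is_star w u.
Proof. by rewrite /star; case: pickP => // ->. Qed.

Definition arm (t : G) (b : bool) (s : seq (bool + option bool)) :=
  exists2 x, adj v x /\ f x = b & walk col t s x.

Lemma arm_cons x t b s : adj x t -> arm t b s -> arm x b (col x t :: s).
Proof. by move=> xt [y vy ty]; exists y => //; apply: walkS xt ty. Qed.

Lemma arm0 u : adj v u -> arm u (f u) [::].
Proof. by move=> vu; exists u => //; apply: walk0. Qed.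

Lemma join_arms x y b s t :
  arm x b s -> arm y (~~ b) t -> uniq (s ++ inl b :: inl (~~ b) :: rev t) ->
  exists2 r, walk col x r y & uniq r.
Proof.
move=> [a [va fa] xa] [c [vc fc] yc] ust.
exists (s ++ inl b :: inl (~~ b) :: rev t) => //.
apply: walk_cat xa _; rewrite -fa -col_center //; apply: walkS.
  by rewrite adj_sym.
rewrite fa -fc -(col_center vc) colC; apply: walkS vc _.
exact: (walk_rev colC).
Qed.

Notation side b := (inr (Some b) : bool + option bool).
Notation link := (inr None : bool + option bool).

(** These words come from a direct edge, a swapped edge followed by an edge inside N, and a step
    inside F followed by an edge to N. All avoid [side (~~ b)]. *)
Definition far_arms b : seq (seq (bool + option bool)) :=
  [:: [:: side b]; [:: side b; link]; [:: link; side b]].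

Lemma arm_far w u : far w -> adj w u -> adj v u -> star w != Some u ->
  exists2 s, s \in far_arms (~~ f u) & arm w (~~ f u) s.
Proof.
move=> Fw wu vu; have uw : adj u w by rewrite adj_sym.
case wE: (star w) => [x|] xu.
  have /and5P[wx vx /existsP[y /and3P[vy xy /eqP fy]] _ _] := starP wE.
  exists [:: side (~~ f u); link]; first by rewrite !inE eqxx ?orbT.
  have fu := star_mono wE wu vu.
  have <- : col w x = side (~~ f u) by rewrite col_cross // /cross wE eqxx addbT fu.
  rewrite -(col_near vx vy); apply: arm_cons wx _; apply: arm_cons xy _.
  by rewrite fu -fy; apply: arm0.
have [y /and3P[wy vy /eqP fy]|mono] := pickP [pred y | [&& adj w y, adj v y & f y == ~~ f u]].
  exists [:: side (~~ f u)]; first by rewrite !inE eqxx.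
  have <- : col w y = side (~~ f u) by rewrite col_cross // /cross wE addbF fy.
  by apply: arm_cons wy _; rewrite -fy; apply: arm0.
have {}mono y : adj w y -> adj v y -> f y = f u.
  by move=> wy vy; have := mono y; rewrite /= wy vy /=; case: (f y) (f u) => [] [].
have [ty /and5P[Ft wt tadjy vy /eqP fy]|fmono] :=
  pickP [pred ty | [&& far ty.1, adj w ty.1, adj ty.1 ty.2, adj v ty.2 & f ty.2 == ~~ f u]].
  case: ty => t y /= in Ft wt tadjy vy fy.
  exists [:: link; side (~~ f u)]; first by rewrite !inE eqxx ?orbT.
  have <- : col t y = side (~~ f u).
    (* Were the edge from [t] to [y] swapped, all neighbors in N of the far vertex [w] would be in
       the class of [y], but [u] is not. *)
    rewrite col_cross // /cross fy; case: eqP => [tE|]; last by rewrite addbF.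
    have tw : adj t w by rewrite adj_sym.
    by have := star_far_mono tE Fw tw wu vu; rewrite fy; case: (f u).
  rewrite -(col_far Fw Ft); apply: arm_cons wt _; apply: arm_cons tadjy _.
  by rewrite -fy; apply: arm0.
have {}fmono t y : far t -> adj w t -> adj t y -> adj v y -> f y = f u.
  move=> Ft wt ty vy; have := fmono (t, y).
  by rewrite /= Ft wt ty vy /=; case: (f y) (f u) => [] [].
(* With no arm found so far, a common neighbor [t] of [w] and [y] lies in N and satisfies
   [is_star w t], contrary to [star w = None]. *)
have [y [vy uy fy]] := opp_nonadj vu Fw uw.
have wNy : ~~ adj w y by apply/negP => /mono/(_ vy); rewrite fy; case: (f u).
have wy : w != y by apply: contraTneq vy => <-; case/andP: Fw.
have [t wt ty] := diam2 wy wNy.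
have [vt|Ft] := nbr_far Fw wt; last first.
  by have := fmono _ _ Ft wt ty vy; rewrite fy; case: (f u).
case/negP: (star_None t wE); rewrite /is_star wt vt /= (mono t wt vt).
apply/and3P; split.
- by apply/existsP; exists y; rewrite vy ty fy eqxx.
- by apply/forallP => z; apply/implyP => /andP[wz vz]; rewrite mono.
- apply/forallP => z; apply/forallP => z'; apply/implyP => /and4P[Fz wz zz' vz'].
  by rewrite (fmono z).
Qed.

(** If the edge from [w] to [x] is swapped, let [y] be opposite and nonadjacent to [x]. A common
    neighbor of [w] and [y] is not [x], and it lies in N because [is_star w x] forbids routes from
    [w] through F to the class of [y]. *)
Lemma far_nonstar w : far w -> exists u, [/\ adj w u, adj v u & star w != Some u].
Proof.
move=> Fw; case wE: (star w) => [x|]; last first.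
  have /andP[wv vw] := Fw; have [] // := @diam2 w v; first by rewrite adj_sym.
  by move=> t wt tv; exists t; split=> //; rewrite adj_sym.
have /and5P[wx vx _ _ _] := starP wE; have xw : adj x w by rewrite adj_sym.
have [y [vy xy fy]] := opp_nonadj vx Fw xw.
have wNy : ~~ adj w y.
  by apply/negP => wy; have := star_mono wE wy vy; rewrite fy; case: (f x).
have wy : w != y by apply: contraTneq vy => <-; case/andP: Fw.
have [t wt ty] := diam2 wy wNy.
have xt : Some x != Some t by apply: contraNneq xy => -[->].
have [vt|Ft] := nbr_far Fw wt; first by exists t.
by have := star_far_mono wE Ft wt ty vy; rewrite fy; case: (f x).
Qed.

Definition near_arm (s : seq (bool + option bool)) :=
  uniq s && all (mem [:: side true; side false; link]) s.

Lemma arm_near u : adj v u ->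
  exists2 s, near_arm s & arm u (~~ f u) s.
Proof.
move=> vu.
have far_case w : far w -> adj u w -> exists2 s, near_arm s & arm u (~~ f u) s.
  move=> Fw uw; have wu : adj w u by rewrite adj_sym.
  have [wE|wNE] := eqVneq (star w) (Some u).
    have /and5P[_ _ /existsP[y /and3P[vy uy /eqP fy]] _ _] := starP wE.
    exists [:: link] => //.
    by rewrite -(col_near vu vy); apply: arm_cons uy _; rewrite -fy; apply: arm0.
  (* The word [s] avoids [side (f u)], the color of the unswapped edge from [u] to [w]. *)
  have [s sP ws] := arm_far Fw wu vu wNE.
  exists (side (f u) :: s).
    by move: sP; rewrite !inE; case: (f u) => /or3P[] /eqP ->.
  have <- : col u w = side (f u).
    by rewrite colC col_cross // /cross (negPf wNE) addbF.
  exact: arm_cons uw ws.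
have [w /andP[Fw uw]|noF] := pickP [pred w | far w && adj u w].
  exact: far_case Fw uw.
have {}noF w : far w -> ~~ adj u w.
  by move=> Fw; have /= := noF w; rewrite Fw /= => ->.
have [[y [vy uy fy]]|[w [y [z [Fw wy wz vy [vz fy]]]]]] := opp_adj vu noF.
  exists [:: link] => //.
  by rewrite -(col_near vu vy); apply: arm_cons uy _; rewrite -fy; apply: arm0.
(* No edge at [w] is swapped, so a detour from [u] through N to [w] can leave [w] into the other
   class with a new color. *)
have wE := star_mixed wy wz vy vz fy.
have uNw := noF w Fw.
have uw : u != w by apply: contraTneq vu => ->; case/andP: Fw.
have [t ut tw] := diam2 uw uNw; have wt : adj w t by rewrite adj_sym.
have vt : adj v t.
  by have [//|/noF] := nbr_far Fw wt; rewrite ut.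
have [ft|ft] := eqVneq (f t) (~~ f u).
  exists [:: link] => //.
  by rewrite -(col_near vu vt); apply: arm_cons ut _; rewrite -ft; apply: arm0.
have {}ft : f t = f u by move: ft; case: (f t) (f u) => [] [].
have [x [wx vx fx]] : exists x, [/\ adj w x, adj v x & f x = ~~ f u].
  have [yu|yu] := eqVneq (f y) (~~ f u); first by exists y.
  by exists z; split=> //; move: fy yu; case: (f y) (f z) (f u) => [] [] [].
exists [:: link; side (f u); side (~~ f u)]; first by case: (f u).
have <- : col t w = side (f u) by rewrite colC col_cross // /cross wE addbF ft.
have <- : col w x = side (~~ f u) by rewrite col_cross // /cross wE addbF fx.
rewrite -(col_near vu vt); apply: arm_cons ut _; apply: arm_cons tw _.
by apply: arm_cons wx _; rewrite -fx; apply: arm0.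
Qed.

(** The word [s] is a shortest way into N. For far [t], membership in [far_arms] is kept because
    such words avoid [side b], as needed to join two far vertices with the same [b]. *)
Lemma arms t : t != v -> exists b s s',
  [/\ arm t b s, arm t (~~ b) s', near_arm s' &
      if adj v t then s = [::] else s = [:: side b] /\ s' \in far_arms (~~ b)].
Proof.
move=> tv; case vt: (adj v t).
  have [s' s'P ts'] := arm_near vt.
  by exists (f t), [::], s'; split=> //; apply: arm0.
have Ft : far t by rewrite /far tv vt.
have [u [tu vu uNstar]] := far_nonstar Ft.
have [s' s'P ts'] := arm_far Ft tu vu uNstar.
exists (f u), [:: side (f u)], s'; split=> //.
  have <- : col t u = side (f u) by rewrite col_cross // /cross (negPf uNstar) addbF.
  by apply: arm_cons tu _; apply: arm0.
by move: s'P; rewrite !inE; case: (f u) => /or3P[] /eqP ->.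
Qed.

Lemma uniq_join b s t : uniq (s ++ t) ->
    all (mem [:: side true; side false; link]) (s ++ t) ->
  uniq (s ++ inl b :: inl (~~ b) :: rev t).
Proof.
move=> ust st; rewrite (perm_uniq (s2 := inl b :: inl (~~ b) :: s ++ t)).
  rewrite /= ust andbT inE; apply/andP; split.
    by apply/norP; split; [case: b | apply/negP => /(allP st)].
  by apply/negP => /(allP st).
by rewrite -!(cat1s _ (_ :: _)) -[inl _ :: rev t]cat1s perm_catCA /= !perm_cons
  -[_ :: rev t]cat1s perm_catCA perm_cons perm_cat2l perm_rev.
Qed.

Lemma rainbow_walk x y : x != y -> exists2 r, walk col x r y & uniq r.
Proof.
have center t : t != v -> exists2 r, walk col t r v & uniq r.
  move=> tv; have [b [s [s' [[a [va fa] ta] _ _ sE]]]] := arms tv.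
  exists (s ++ [:: col a v]).
    by apply: walk_cat ta (walk1 _ _); rewrite adj_sym.
  by rewrite col_center //; move: sE; case: (adj v t) => [sE|[sE _]]; rewrite sE.
have [->|xv] := eqVneq x v.
  rewrite eq_sym => /center[r yr ur]; exists (rev r); rewrite ?rev_uniq //.
  exact: (walk_rev colC).
have [->|yv _] := eqVneq y v; first exact: center.
have [b [s [s' [xs xs' s'P xE]]]] := arms xv.
have [c [t [t' [yt yt' t'P yE]]]] := arms yv.
(* If the short arms enter different classes, they join directly; otherwise one endpoint switches to
   its other arm. *)
have [cb|cb] := eqVneq c (~~ b).
  rewrite cb in yt yE; apply: (join_arms xs yt).
  move: xE yE; case: (adj v x) => [sE|[sE _]];
    by case: (adj v y) => [tE|[tE _]]; rewrite sE tE; case: (b).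
have {}cb : c = b by move: cb; case: (b) (c) => [] [].
rewrite {}cb in yt yt' yE.
move: xE; case: (adj v x) => [sE|[sE s'F]].
  rewrite {}sE in xs; apply: (join_arms xs yt').
  by case/andP: t'P => ut' t'C; apply: uniq_join.
move: yE; case: (adj v y) => [tE|[_ t'F]].
  rewrite {}tE in yt; rewrite -[b]negbK in yt; apply: (join_arms xs' yt).
  by case/andP: s'P => us' s'C; apply: uniq_join; rewrite cats0.
apply: (join_arms xs yt'); rewrite sE.
by move: t'F; rewrite !inE; case: (b) => /or3P[] /eqP ->.
Qed.

Lemma coloring_rainbow : rainbow_colorable G 5.
Proof.
have <- : #|{: bool + option bool}| = 5 by rewrite card_sum card_option card_bool.
exact: (walk_rainbow_colorable colC rainbow_walk).
Qed.

End Coloring.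

(** * Diameter, maximum degree and the choice of the classes *)

Lemma diameter2P (G : sgraph) : diameter G = Some 2 -> connected G /\
  forall x y : G, x != y -> ~~ adj x y -> exists2 t, adj x t & adj t y.
Proof.
rewrite /diameter; case: ifP => // cG [] diamE; split=> // x y xy xNy.
have: dist x y <= 2.
  rewrite -diamE; apply: leq_trans (leq_bigmax _).
  exact: (leq_bigmax (F := fun z => dist x z)).
have [[[|a [|b [|? ?]]] /and3P[/= xp /eqP yE _] <-] _] := distP x y cG => //.
- by case/eqP: xy.
- by rewrite -yE -[a]/(last a [::]) in xNy *; move: xp xNy; rewrite andbT => ->.
- by case/and3P: xp => xa ab _; exists a; rewrite // -yE.
Qed.

(** Otherwise [u] would be adjacent to [v], [w] and all of N except itself, exceeding the degree of
    [v]. *)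
Lemma max_degree_nonadj (G : sgraph) (v : G) :
    (forall u : G, #|[set x | adj u x]| <= #|[set x | adj v x]|) ->
  forall u w, adj v u -> far v w -> adj u w ->
  exists y, [/\ adj v y, y != u & ~~ adj u y].
Proof.
move=> vmax u w vu /andP[wv vw] uw.
have [y /and3P[vy yu uy]|dom] := pickP [pred y | [&& adj v y, y != u & ~~ adj u y]].
  by exists y.
suff: #|[set x | adj v x]| < #|[set x | adj u x]| by rewrite ltnNge vmax.
have uv : adj u v by rewrite adj_sym.
rewrite (cardsD1 v [set x | adj u x]) inE uv (cardsD1 w (_ :\ v)) !inE wv uw.
rewrite (cardsD1 u [set x | adj v x]) inE vu !add1n ltnS.
rewrite ltnS; apply: subset_leq_card; apply/subsetP => y; rewrite !inE => /andP[yu vy].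
have := dom y; rewrite /= vy yu /= => /negbFE ->; rewrite andbT.
apply/andP; split; first by apply: contraNneq vw => <-.
by apply: contraTneq vy => ->; rewrite adj_irrefl.
Qed.

Lemma good_partition (G : sgraph) (v : G) :
    (forall x y : G, x != y -> ~~ adj x y -> exists2 t, adj x t & adj t y) ->
    (forall u w, adj v u -> far v w -> adj u w ->
      exists y, [/\ adj v y, y != u & ~~ adj u y]) ->
    ((forall w, ~~ far v w) -> forall u, adj v u -> exists2 y, adj v y & adj u y) ->
  exists f : G -> bool,
    (forall u w, adj v u -> far v w -> adj u w ->
       exists y, [/\ adj v y, ~~ adj u y & f y = ~~ f u]) /\
    (forall u, adj v u -> (forall w, far v w -> ~~ adj u w) ->
       (exists y, [/\ adj v y, adj u y & f y = ~~ f u]) \/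
       (exists w y z,
          [/\ far v w, adj w y, adj w z, adj v y & adj v z /\ f y = ~~ f z])).
Proof.
move=> diam2 nonadj dominating.
have [w0 Fw0|nofar] := pickP (far v); last first.
  have {}dominating := dominating (fun w => negbT (nofar w)).
  have [||f fP] := @opposite_neighbor G [rel x y | [&& adj v x, adj v y & adj x y]].
  - by move=> x y /=; rewrite (adj_sym x y) andbCA.
  - by move=> x /=; rewrite adj_irrefl !andbF.
  exists f; split=> [u w _|u vu _]; first by rewrite nofar.
  left; have [|y /and3P[_ vy uy] fy] := fP u; last by exists y.
  by have [y vy uy] := dominating u vu; exists y; rewrite /= vu vy.
pose U u := [exists w, far v w && adj u w].
(* Since [z] has no neighbor in F, its common neighbor with [w] lies in N, hence in [U]. *)
have toU z w : adj v z -> ~~ U z -> far v w -> exists t, [/\ adj v t, U t, adj z t & adj t w].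
  move=> vz zU Fw; have zNw : ~~ adj z w.
    by apply: contra zU => zw; apply/existsP; exists w; rewrite Fw.
  have zw : z != w by apply: contraTneq vz => ->; case/andP: Fw.
  have [t zt tw] := diam2 z w zw zNw; exists t; split=> //.
    have wt : adj w t by rewrite adj_sym.
    have [//|Ft] := nbr_far Fw wt.
    by case/negP: zU; apply/existsP; exists t; rewrite Ft.
  by apply/existsP; exists w; rewrite Fw.
have [||f fP] := @opposite_neighbor G
    [rel x y | [&& adj v x, adj v y, y != x & ~~ adj x y]].
- by move=> x y /=; rewrite (adj_sym x y) andbCA (eq_sym x y).
- by move=> x /=; rewrite eqxx !andbF.
have {}fP u w : adj v u -> far v w -> adj u w ->
    exists y, [/\ adj v y, ~~ adj u y & f y = ~~ f u].
  move=> vu Fw uw; have [|y /and4P[_ vy yu uy] fy] := fP u; last by exists y.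
  by have [y [vy yu uy]] := nonadj u w vu Fw uw; exists y; rewrite /= vu vy yu uy.
(* If f is constant on the set U of vertices of N adjacent to F, replace f by U. *)
have [/existsP[b /forallP Ub]|] := boolP [exists b, forall u, (adj v u && U u) ==> (f u == b)].
  exists U; split=> [u w vu Fw uw|u vu noF].
    have uU : U u by apply/existsP; exists w; rewrite Fw.
    have [y [vy uy fy]] := fP u w vu Fw uw; exists y; split=> //.
    (* As [f] is constant on [U], a vertex opposite to [u] under [f] lies outside [U]. *)
    rewrite uU; apply/negbTE/negP => yU.
    have := Ub u; have := Ub y; rewrite vu vy uU yU /= fy => /eqP <-.
    by case: (f u).
  have uU : ~~ U u.
    by apply/existsP => -[w /andP[/noF/negPf->]].
  left; have [t [vt tU ut _]] := toU u w0 vu uU Fw0.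
  by exists t; split=> //; rewrite tU (negPf uU).
rewrite negb_exists => /forallP nmono; exists f; split=> // u vu noF.
have uU : ~~ U u by apply/existsP => -[w /andP[/noF/negPf->]].
(* Take [y] in [U] opposite to [u] and [w] in F adjacent to [y]. A common neighbor [t] of [u] and
   [w] is opposite to [u], or else [w] sees both classes through [y] and [t]. *)
have := nmono (f u); rewrite negb_forall => /existsP[y].
rewrite negb_imply => /andP[/andP[vy /existsP[w /andP[Fw yw]]] fy].
have [t [vt _ ut tw]] := toU u w vu uU Fw.
have [ft|ft] := eqVneq (f t) (~~ f u); [by left; exists t | right].
exists w, y, t; split=> //; try by rewrite adj_sym.
by split=> //; move: fy ft; case: (f y) (f t) (f u) => [] [] [].
Qed.

Theorem theorem8 (G : sgraph) (bridgeless_G : bridgeless G)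
    (diameter_G : diameter G = Some 2) : rc G <= 5.
Proof.
have [cG diam2] := diameter2P diameter_G.
have [_ rc_min] := rcP cG; apply: rc_min.
have [v0 _|G0] := pickP (@predT G); last first.
  by apply/existsP; exists [ffun=> ord0]; apply/forallP => x; have := G0 x.
pose deg (v : G) := #|[set x | adj v x]|.
have [v _ vmax] := arg_maxnP deg (erefl (predT v0)).
have {}vmax u : deg u <= deg v by apply: vmax.
have nonadj := max_degree_nonadj vmax.
have dominating : (forall w, ~~ far v w) ->
    forall u, adj v u -> exists2 y, adj v y & adj u y.
  move=> nofar u vu; have uvE : [set u; v] \in edges G.
    by apply/imsetP; exists (u, v); rewrite ?inE //= adj_sym.
  (* A path from [u] to [v] avoiding their edge starts with some [y] other than [v]; with F empty,
     [y] is adjacent to [v]. *)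
  have := bridgeless_G _ uvE => /forallP/(_ u)/forallP/(_ v)/connectP[[|y p]] /=.
    by move=> _ uv; move: vu; rewrite uv adj_irrefl.
  case/andP=> /andP[uy yE] _ _; exists y => //.
  have := nofar y; rewrite /far negb_and !negbK => /orP[/eqP yv|//].
  by rewrite yv eqxx in yE.
have [f [opp_nonadj opp_adj]] := good_partition diam2 nonadj dominating.
exact: coloring_rainbow diam2 opp_nonadj opp_adj.
Qed.
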